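(* Let $(\xi,\zeta)$ be a grid point and consider an interior grid point $(x_i,y_j)\in\Gamma_1$. Assume that $u_p$ and $f_p$ have uniformly continuous partial derivatives of (total) orders up to seven and five, respectively, in $\Omega_p$ for $p=1,2$, and that the one-dimensional functions $\phi_1$ and $\psi_1$ on $\Gamma_1$ have uniformly continuous derivatives of orders up to seven and six, respectively. Let $(x_i^*,y_j^* ):=(x_i,y_j)$ and let $\mathcal{L}_h$ be the discrete operator with stencil coefficients $$C_{1,0}=-4,\quad C_{1,-1}=C_{1,1}=-1,\quad C_{-1,-1}=C_{-1,1}=-\alpha,\quad C_{0,-1}=C_{0,1}=-2(1+\alpha),$$ $$C_{-1,0}=-4\alpha,\quad C_{0,0}=10(1+\alpha),\qquad \alpha:=a_1/a_2>0 .$$ Then the compact 9-point finite difference scheme $h^{-1}\mathcal{L}_hu_h=h^{-1}F$ has a seventh order of consistency at the grid point $(x_i,y_j)\in\Gamma_1$, i.e. $h^{-1}(\mathcal{L}_hu-F)=O(h^7)$ as $h\to0$, where $$F:=\frac1{a_1}\sum_{(m,n)\in\Lambda_5}f_1^{(m,n)}H^{-}_{m,n}+\frac1{a_2}\sum_{(m,n)\in\Lambda_5}f_2^{(m,n)}H^{+}_{m,n}-\sum_{n=0}^{7}\phi_1^{(n)}\mathcal{G}_{0,n}-\frac1{a_1}\sum_{n=0}^{6}\psi_1^{(n)}\mathcal{G}_{1,n}.$$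
   Context: **Problem.** Let $l_1<l_2$, $l_3<l_4$ be real with $l_4-l_3=N_0(l_2-l_1)$ for a positive integer $N_0$, let $\Omega=(l_1,l_2)\times(l_3,l_4)$ and $(\xi,\zeta)\in\Omega$. Put $\Gamma_1=\{\xi\}\times(\zeta,l_4)$, $\Gamma_2=\{\xi\}\times(l_3,\zeta)$, $\Gamma_3=(\xi,l_2)\times\{\zeta\}$, $\Gamma_4=(l_1,\xi)\times\{\zeta\}$, $\Gamma=\Gamma_1\cup\Gamma_2\cup\Gamma_3\cup\Gamma_4\cup\{(\xi,\zeta)\}$, and $\Omega_1=(l_1,\xi)\times(\zeta,l_4)$, $\Omega_2=(\xi,l_2)\times(\zeta,l_4)$, $\Omega_3=(\xi,l_2)\times(l_3,\zeta)$, $\Omega_4=(l_1,\xi)\times(l_3,\zeta)$. The coefficient $a$ equals a positive constant $a_p$ on $\Omega_p$; $u_p$ and $f_p$ denote the restrictions of $u$ and $f$ to $\Omega_p$ (with their derivatives extended continuously to $\overline{\Omega_p}$). The function $u$ is the exact solution of the elliptic cross-interface problem $$-\nabla\cdot(a\nabla u)=f\ \text{in }\Omega\setminus\Gamma,\quad [u]=\phi_p,\ [a\nabla u\cdot\vec n]=\psi_p\ \text{on }\Gamma_p\ (p=1,2,3,4),\quad u=g\ \text{on }\partial\Omega .$$ On $\Gamma_1,\Gamma_2$ the bracket is the limit $x\to\xi^+$ minus the limit $x\to\xi^-$ and $a\nabla u\cdot\vec n=a\,\partial u/\partial x$; on $\Gamma_3,\Gamma_4$ it is the limit $y\to\zeta^+$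 minus the limit $y\to\zeta^-$ and $a\nabla u\cdot\vec n=a\,\partial u/\partial y$. **Mesh.** $x_i=l_1+ih$ ($0\le i\le N_1$), $y_j=l_3+jh$ ($0\le j\le N_2$), $h=(l_2-l_1)/N_1$, $N_2=N_0N_1$; interior grid points are those in $\Omega$. For real stencil coefficients $C_{k,\ell}$, $k,\ell\in\{-1,0,1\}$, $\mathcal{L}_hu_h:=\sum_{k,\ell=-1}^1C_{k,\ell}(u_h)_{i+k,j+\ell}$ for a grid function $u_h$, and $\mathcal{L}_hu:=\sum_{k,\ell=-1}^1C_{k,\ell}\,u(x_i+kh,y_j+\ell h)$ for the exact solution, where at a grid point of $\Gamma_1$ the values for $k=-1$ are those of $u_1$ and the values for $k=0,1$ are those of $u_2$ (continuous extensions). The scheme $h^{-1}\mathcal{L}_hu_h=h^{-1}F$ has order of consistency $r$ if $h^{-1}(\mathcal{L}_hu-F)=O(h^r)$ as $h\to0$ (constant independent of $h$), over meshes satisfying the stated conditions. **Notation.** At $(x_i^*,y_j^* )\in\Gamma_1$: $f_p^{(m,n)}=\frac{\partial^{m+n}f_p}{\partial x^m\partial y^n}(x_i^*,y_j^* )$, $\phi_1^{(n)}=\frac{d^n}{dy^n}\phi_1(\xi,y)|_{y=y_j^*}$, $\psi_1^{(n)}=\frac{d^n}{dy^n}\psi_1(\xi,y)|_{y=y_j^*}$. $\Lambda_M=\{(m,n)\in\mathbb{Z}_{\ge0}^2: m+n\le M\}$. For nonnegative integers $m,n$, $$G_{m,n}(x,y)=\sum_{\ell=0}^{\lfloor n/2\rfloor}\frac{(-1)^\ell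 x^{m+2\ell}y^{n-2\ell}}{(m+2\ell)!(n-2\ell)!},\qquad H_{m,n}(x,y)=\sum_{\ell=1}^{1+\lfloor n/2\rfloor}\frac{(-1)^\ell x^{m+2\ell}y^{n-2\ell+2}}{(m+2\ell)!(n-2\ell+2)!},$$ $$\mathcal{G}_{m,n}=\sum_{\ell=-1}^1C_{-1,\ell}G_{m,n}(-h,\ell h),\quad H^-_{m,n}=\sum_{\ell=-1}^1C_{-1,\ell}H_{m,n}(-h,\ell h),\quad H^+_{m,n}=\sum_{k=0}^1\sum_{\ell=-1}^1C_{k,\ell}H_{m,n}(kh,\ell h).$$
   Formalization: The formal theorem also assumes that the seventh-order partial derivatives of u_1 and u_2 are Lipschitz on Ω_1 and Ω_2; with uniform continuity alone the claim fails, e.g. a=1, ξ=1, u=max(1-x,0)^{15/2} gives F=0 and error -6h^{13/2}. *)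

(* Defs.v *)
From Stdlib Require Import Reals ZArith List Arith.
From Coquelicot Require Import Coquelicot.
Import ListNotations.
Open Scope R_scope.

(** * Geometry *)

Record cross := Cross {
  l1 : R; l2 : R; l3 : R; l4 : R;
  N0 : nat;
  xi : R; zeta : R;
  l1_lt_l2 : l1 < l2;
  l3_lt_l4 : l3 < l4;
  N0_pos : (0 < N0)%nat;
  sides : l4 - l3 = INR N0 * (l2 - l1);
  xi_in : l1 < xi < l2;
  zeta_in : l3 < zeta < l4
}.

(** The index [p = 1,2,3,4] of the pieces [Omega_p], [Gamma_p], [a_p], ... *)
Inductive piece := P1 | P2 | P3 | P4.

Definition Omega (D : cross) (x y : R) : Prop :=
  l1 D < x < l2 D /\ l3 D < y < l4 D.

Definition boundary (D : cross) (x y : R) : Prop :=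
  (l1 D <= x <= l2 D /\ l3 D <= y <= l4 D) /\ ~ Omega D x y.

Definition Omega_ (D : cross) (p : piece) (x y : R) : Prop :=
  match p with
  | P1 => l1 D < x < xi D /\ zeta D < y < l4 D
  | P2 => xi D < x < l2 D /\ zeta D < y < l4 D
  | P3 => xi D < x < l2 D /\ l3 D < y < zeta D
  | P4 => l1 D < x < xi D /\ l3 D < y < zeta D
  end.

Definition Gamma_ (D : cross) (p : piece) (x y : R) : Prop :=
  match p with
  | P1 => x = xi D /\ zeta D < y < l4 D
  | P2 => x = xi D /\ l3 D < y < zeta D
  | P3 => xi D < x < l2 D /\ y = zeta D
  | P4 => l1 D < x < xi D /\ y = zeta D
  end.

Definition Gamma (D : cross) (x y : R) : Prop :=
  (exists p, Gamma_ D p x y) \/ (x = xi D /\ y = zeta D).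

(** * Partial derivatives and continuous extensions *)

Definition dx (w : R -> R -> R) (x y : R) : R := Derive (fun t => w t y) x.
Definition dy (w : R -> R -> R) (x y : R) : R := Derive (fun t => w x t) y.

Definition uniformly_continuous_on (A : R -> R -> Prop) (w : R -> R -> R) : Prop :=
  forall eps : posreal, exists delta : posreal,
  forall x y x' y', A x y -> A x' y' ->
    Rabs (x - x') < delta -> Rabs (y - y') < delta ->
    Rabs (w x y - w x' y') < eps.

(** All iterated partial derivatives of total order at most [M], taken in any
    order of differentiation, exist and are uniformly continuous on [A].  It is
    only used for open [A], so that it depends only on the restriction of [w]
    to [A]. *)
Fixpoint uc_partials (A : R -> R -> Prop) (M : nat) (w : R -> R -> R) : Prop :=
  uniformly_continuous_on A w /\
  match M with
  | O => True
  | S M' =>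
      (forall x y, A x y ->
         ex_derive (fun t => w t y) x /\ ex_derive (fun t => w x t) y) /\
      uc_partials A M' (dx w) /\ uc_partials A M' (dy w)
  end.

Definition uc_derivatives (A : R -> Prop) (M : nat) (w : R -> R) : Prop :=
  forall n, (n <= M)%nat ->
    (forall t, A t -> ex_derive_n w n t) /\
    uniform_continuity (Derive_n w n) A.

Definition lipschitz_on (A : R -> R -> Prop) (w : R -> R -> R) : Prop :=
  exists L : R, forall x y x' y', A x y -> A x' y' ->
    Rabs (w x y - w x' y') <= L * (Rabs (x - x') + Rabs (y - y')).

(** The value at a point of the closure of [Omega_p] of the continuous extension
    of the restriction of [w] to [Omega_p]; arbitrary if the limit does not
    exist. *)
Definition extension (D : cross) (p : piece) (w : R -> R -> R) (x y : R) : R :=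
  iota (fun l : R =>
    filterlim (fun z : R * R => w (fst z) (snd z))
      (within (fun z => Omega_ D p (fst z) (snd z)) (locally (x, y)))
      (locally l)).

(** * The elliptic cross-interface problem *)

(** The limit at [c] from the right minus the limit from the left is [v]. *)
Definition jump (w : R -> R) (c v : R) : Prop :=
  exists r l : R,
    filterlim w (at_right c) (locally r) /\
    filterlim w (at_left c) (locally l) /\
    r - l = v.

Definition pde_at (a f u : R -> R -> R) (x y : R) : Prop :=
  ex_derive (fun t => u t y) x /\
  ex_derive (fun t => u x t) y /\
  ex_derive (fun t => a t y * dx u t y) x /\
  ex_derive (fun t => a x t * dy u x t) y /\
  - (Derive (fun t => a t y * dx u t y) x
     + Derive (fun t => a x t * dy u x t) y) = f x y.

Definition jump_conditions (D : cross) (a : R -> R -> R)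
    (phi psi : piece -> R -> R) (u : R -> R -> R) (p : piece) : Prop :=
  forall x y, Gamma_ D p x y ->
    match p with
    | P1 | P2 =>
        jump (fun t => u t y) (xi D) (phi p y) /\
        jump (fun t => a t y * dx u t y) (xi D) (psi p y)
    | P3 | P4 =>
        jump (fun t => u x t) (zeta D) (phi p x) /\
        jump (fun t => a x t * dy u x t) (zeta D) (psi p x)
    end.

(** The boundary values are attained as limits from [Omega], except at the four
    points where [Gamma] meets the boundary: there the one-sided limits of [u]
    may differ. *)
Record exact_solution (D : cross) (a f : R -> R -> R)
    (phi psi : piece -> R -> R) (g u : R -> R -> R) : Prop := {
  solves_pde : forall x y, Omega D x y -> ~ Gamma D x y -> pde_at a f u x y;
  has_jumps : forall p, jump_conditions D a phi psi u p;
  boundary_values : forall x y, boundary D x y -> u x y = g x y;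
  boundary_limits : forall x y, boundary D x y -> x <> xi D -> y <> zeta D ->
    filterlim (fun z : R * R => u (fst z) (snd z))
      (within (fun z => Omega D (fst z) (snd z) /\ ~ Gamma D (fst z) (snd z))
         (locally (x, y)))
      (locally (g x y))
}.

(** * Mesh and stencils *)

Definition mesh_size (D : cross) (N1 : nat) : R := (l2 D - l1 D) / INR N1.
Definition grid_x (D : cross) (N1 i : nat) : R := l1 D + INR i * mesh_size D N1.
Definition grid_y (D : cross) (N1 j : nat) : R := l3 D + INR j * mesh_size D N1.

(** [(i, j)] is the index of a grid point, with [N_2 = N_0 N_1]. *)
Definition grid_index (D : cross) (N1 i j : nat) : Prop :=
  (i <= N1)%nat /\ (j <= N0 D * N1)%nat.

Definition sumZ (s : list Z) (F : Z -> R) : R :=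
  fold_right (fun k acc => F k + acc) 0 s.

(** The 9-point operator, applied to the local values [v k l] at the nodes
    [(i + k, j + l)]. *)
Definition Lh (C v : Z -> Z -> R) : R :=
  sumZ [-1; 0; 1]%Z (fun k => sumZ [-1; 0; 1]%Z (fun l => C k l * v k l)).

(** The values of the exact solution around the point [(x, y)] of [Gamma_1]. *)
Definition exact_values (D : cross) (u : R -> R -> R) (h x y : R) (k l : Z) : R :=
  extension D (if (k =? -1)%Z then P1 else P2) u (x + IZR k * h) (y + IZR l * h).

Definition stencil (alpha : R) (k l : Z) : R :=
  match k, l with
  | 1%Z, 0%Z => -4
  | 1%Z, (-1)%Z | 1%Z, 1%Z => -1
  | (-1)%Z, (-1)%Z | (-1)%Z, 1%Z => - alpha
  | 0%Z, (-1)%Z | 0%Z, 1%Z => - 2 * (1 + alpha)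
  | (-1)%Z, 0%Z => - 4 * alpha
  | 0%Z, 0%Z => 10 * (1 + alpha)
  | _, _ => 0
  end.

(** * The polynomials [G], [H] and the right-hand side [F] *)

Definition G (m n : nat) (x y : R) : R :=
  sum_f_R0 (fun l =>
    (-1) ^ l * x ^ (m + 2 * l) * y ^ (n - 2 * l)
    / (INR (fact (m + 2 * l)) * INR (fact (n - 2 * l)))) (n / 2).

(** [sum_f 1 N] sums over [1 <= l <= N]; the exponent [n - 2 l + 2] is written
    [n + 2 - 2 l] because subtraction on [nat] is truncated. *)
Definition H (m n : nat) (x y : R) : R :=
  sum_f 1 (1 + n / 2) (fun l =>
    (-1) ^ l * x ^ (m + 2 * l) * y ^ (n + 2 - 2 * l)
    / (INR (fact (m + 2 * l)) * INR (fact (n + 2 - 2 * l)))).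

Definition calG (C : Z -> Z -> R) (h : R) (m n : nat) : R :=
  sumZ [-1; 0; 1]%Z (fun l => C (-1)%Z l * G m n (- h) (IZR l * h)).

Definition Hminus (C : Z -> Z -> R) (h : R) (m n : nat) : R :=
  sumZ [-1; 0; 1]%Z (fun l => C (-1)%Z l * H m n (- h) (IZR l * h)).

Definition Hplus (C : Z -> Z -> R) (h : R) (m n : nat) : R :=
  sumZ [0; 1]%Z (fun k => sumZ [-1; 0; 1]%Z (fun l =>
    C k l * H m n (IZR k * h) (IZR l * h))).

Definition sum_Lambda (M : nat) (F : nat -> nat -> R) : R :=
  sum_f_R0 (fun m => sum_f_R0 (fun n => F m n) (M - m)) M.

Definition rhs_F (D : cross) (a1 a2 : R) (f : R -> R -> R) (phi1 psi1 : R -> R)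
    (C : Z -> Z -> R) (h x y : R) : R :=
  / a1 * sum_Lambda 5 (fun m n =>
           extension D P1 (partial_derive m n f) x y * Hminus C h m n)
  + / a2 * sum_Lambda 5 (fun m n =>
             extension D P2 (partial_derive m n f) x y * Hplus C h m n)
  - sum_f_R0 (fun n => Derive_n phi1 n y * calG C h 0 n) 7
  - / a1 * sum_f_R0 (fun n => Derive_n psi1 n y * calG C h 1 n) 6.

(* Main.v *)
Require Import Defs.
From Stdlib Require Import Reals ZArith List Arith Lra Lia.
From Coquelicot Require Import Coquelicot.
Import ListNotations.
Open Scope R_scope.

(** Taylor's formula of order seven at [(xi, y_j)], applied in the interior of
    [Omega_p] and carried to the boundary by a limit, has a remainder of order
    [h^8] because the derivatives of order seven are Lipschitz.  The differential
    equation [u_xx = - u_yy - f / a_p] turns the Taylor polynomial of [u_p] into a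
    combination of the harmonic polynomials [G_{0,n}], [G_{1,n}], with the
    derivatives [u_p^{(0,n)}], [u_p^{(1,n)}] as coefficients, plus the terms
    [f_p^{(m,n)} H_{m,n} / a_p].  Tangential derivatives commute with the limit at
    [Gamma_1], so the jump conditions express [u_1^{(0,n)}], [u_1^{(1,n)}] by those
    of [u_2].  The even part vanishes because, up to the factor [1 + alpha], the
    stencil acts on functions even in [x] as half the classical 9-point Laplacian,
    which annihilates harmonic polynomials of degree at most seven; the odd part
    vanishes by the symmetry [C_{-1,l} = alpha C_{1,l}] of the stencil. *)

(** * Limits at the boundary of an open rectangle *)

Definition rect (xa xb ya yb x y : R) : Prop := xa < x < xb /\ ya < y < yb.

Definition clrect (xa xb ya yb x y : R) : Prop := xa <= x <= xb /\ ya <= y <= yb.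

(* [extension D p] is convertible to [limit_from (Omega_ D p)], and each
   [Omega_ D p] to a [rect]. *)
Definition limit_from (A : R -> R -> Prop) (w : R -> R -> R) (x y : R) : R :=
  iota (fun l : R =>
    filterlim (fun z : R * R => w (fst z) (snd z))
      (within (fun z => A (fst z) (snd z)) (locally (x, y)))
      (locally l)).

(** Approaching a point of the closure along a segment from an interior point turns the two-variable
    limit of [extension] into a one-parameter limit at [t = 0] from the right. *)
Definition seg (x c t : R) : R := x + t * (c - x).

Lemma seg_in (xa xb x c t : R) :
  xa <= x <= xb -> xa < c < xb -> 0 < t < 1 -> xa < seg x c t < xb.
Proof. unfold seg; intros Hx Hc Ht; split; nra. Qed.

Lemma at_right_0_lt (b : R) : 0 < b -> at_right 0 (fun t => 0 < t < b).
Proof.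
  intros Hb; exists (mkposreal b Hb); intros t Ht Ht0.
  change (Rabs (t - 0) < b) in Ht.
  rewrite Rminus_0_r, Rabs_pos_eq in Ht; lra.
Qed.

(** By convexity the segment lies in the open rectangle for [0 < t < 1], and its distance to the end
    point is proportional to [t]. *)
Lemma seg_filterlim (xa xb ya yb x y cx cy : R) :
  clrect xa xb ya yb x y -> rect xa xb ya yb cx cy ->
  filterlim (fun t => (seg x cx t, seg y cy t)) (at_right 0)
    (within (fun z => rect xa xb ya yb (fst z) (snd z)) (locally (x, y))).
Proof.
  intros [Hx Hy] [Hcx Hcy] P [eps HP].
  (* [t * M] dominates the displacement in both coordinates; the summand 1 makes [M] positive even
     when the points coincide. *)
  set (M := 1 + Rabs (cx - x) + Rabs (cy - y)).
  assert (Px := Rabs_pos (cx - x)); assert (Py := Rabs_pos (cy - y)).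
  assert (HM : 0 < M) by (unfold M; lra).
  assert (He := cond_pos eps).
  assert (Hd : 0 < Rmin 1 (eps / M)).
  { apply Rmin_pos; [lra | now apply Rdiv_lt_0_compat]. }
  unfold filtermap.
  apply (filter_imp (fun t => 0 < t < Rmin 1 (eps / M)));
    [| now apply at_right_0_lt].
  intros t [Ht0 Ht].
  assert (Ht1 : t < 1) by (eapply Rlt_le_trans; [exact Ht | apply Rmin_l]).
  assert (HtM : t * M < eps).
  { apply Rlt_le_trans with (eps / M * M).
    - apply Rmult_lt_compat_r; trivial.
      eapply Rlt_le_trans; [exact Ht | apply Rmin_r].
    - right; field; lra. }
  apply HP.
  - split; simpl.
    + change (Rabs (seg x cx t - x) < eps).
      unfold seg; replace (x + t * (cx - x) - x) with (t * (cx - x)) by ring.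
      rewrite Rabs_mult, (Rabs_pos_eq t) by lra.
      unfold M in HtM; nra.
    + change (Rabs (seg y cy t - y) < eps).
      unfold seg; replace (y + t * (cy - y) - y) with (t * (cy - y)) by ring.
      rewrite Rabs_mult, (Rabs_pos_eq t) by lra.
      unfold M in HtM; nra.
  - split; simpl; apply seg_in; auto.
Qed.

Lemma within_rect_proper (xa xb ya yb x y : R) :
  clrect xa xb ya yb x y -> xa < xb -> ya < yb ->
  ProperFilter (within (fun z => rect xa xb ya yb (fst z) (snd z)) (locally (x, y))).
Proof.
  intros Hxy Hab Hab'; split; [| apply within_filter, locally_filter].
  intros P HP.
  assert (Hc : rect xa xb ya yb ((xa + xb) / 2) ((ya + yb) / 2)) by (split; lra).
  destruct (filter_ex _ (seg_filterlim _ _ _ _ _ _ _ _ Hxy Hc P HP)) as [z Hz].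
  now exists z.
Qed.

(** Uniform continuity makes the image filter Cauchy, completeness of the reals provides a limit,
    and by uniqueness [iota] selects it. *)
Lemma uniformly_continuous_filterlim (xa xb ya yb x y : R) (w : R -> R -> R) :
  uniformly_continuous_on (rect xa xb ya yb) w ->
  clrect xa xb ya yb x y -> xa < xb -> ya < yb ->
  filterlim (fun z => w (fst z) (snd z))
    (within (fun z => rect xa xb ya yb (fst z) (snd z)) (locally (x, y)))
    (locally (limit_from (rect xa xb ya yb) w x y)).
Proof.
  intros Huc Hxy Hab Hab'.
  assert (PF := within_rect_proper _ _ _ _ _ _ Hxy Hab Hab').
  destruct (proj1 (filterlim_locally_cauchy (U := R_CompleteSpace)
    (F := within (fun z => rect xa xb ya yb (fst z) (snd z)) (locally (x, y)))
    (fun z => w (fst z) (snd z)))) as [l Hl].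
  - intros eps; destruct (Huc eps) as [delta Hd].
    (* Two points within [delta / 2] of the centre are within [delta] of each other. *)
    assert (Hd2 : 0 < delta / 2) by (destruct delta; simpl; lra).
    exists (fun z => rect xa xb ya yb (fst z) (snd z) /\
                     ball (x, y) (mkposreal _ Hd2) z); split.
    + exists (mkposreal _ Hd2); intros z Hz Hr; now split.
    + intros [x1 y1] [x2 y2] [Hr1 [Hx1 Hy1]] [Hr2 [Hx2 Hy2]]; simpl in *.
      change (Rabs (x1 - x) < delta / 2) in Hx1.
      change (Rabs (y1 - y) < delta / 2) in Hy1.
      change (Rabs (x2 - x) < delta / 2) in Hx2.
      change (Rabs (y2 - y) < delta / 2) in Hy2.
      change (Rabs (w x2 y2 - w x1 y1) < eps).
      apply Rabs_def2 in Hx1, Hx2, Hy1, Hy2.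
      apply Hd; trivial; apply Rabs_def1; lra.
  - unfold limit_from.
    erewrite (iota_filterlim_locally (V := R_CompleteNormedModule)); eauto.
Qed.

Lemma limit_from_seg (xa xb ya yb x y cx cy : R) (w : R -> R -> R) :
  uniformly_continuous_on (rect xa xb ya yb) w ->
  clrect xa xb ya yb x y -> rect xa xb ya yb cx cy ->
  filterlim (fun t => w (seg x cx t) (seg y cy t)) (at_right 0)
    (locally (limit_from (rect xa xb ya yb) w x y)).
Proof.
  intros Huc Hxy Hc.
  apply (filterlim_comp _ _ _ (fun t => (seg x cx t, seg y cy t))
           (fun z => w (fst z) (snd z)) _ _ _
           (seg_filterlim _ _ _ _ _ _ _ _ Hxy Hc)).
  apply uniformly_continuous_filterlim; trivial; destruct Hc; lra.
Qed.

(** The predicates under the two [iota] are equivalent, so the chosen values are close, and close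
    reals are equal. This allows rewriting by identities that hold on [A] only. *)
Lemma limit_from_ext (A : R -> R -> Prop) (v w : R -> R -> R) (x y : R) :
  (forall x y, A x y -> v x y = w x y) -> limit_from A v x y = limit_from A w x y.
Proof.
  intros Hvw; unfold limit_from.
  apply (eq_close (K := R_AbsRing) (V := R_NormedModule)).
  apply (close_iota (T := R_CompleteSpace)); intros l; split;
    apply filterlim_ext_loc; exists (mkposreal 1 Rlt_0_1); intros z _ Hz;
    [| symmetry]; now apply Hvw.
Qed.

(** * Arithmetic of limits *)

Lemma filterlim_Rplus {T} (F : (T -> Prop) -> Prop) {FF : Filter F}
  (f g : T -> R) (a b : R) :
  filterlim f F (locally a) -> filterlim g F (locally b) ->
  filterlim (fun t => f t + g t) F (locally (a + b)).
Proof.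
  intros Hf Hg; apply (filterlim_comp_2 _ _ _ Hf Hg).
  apply (filterlim_plus (K := R_AbsRing) (V := R_NormedModule)).
Qed.

Lemma filterlim_Rmult {T} (F : (T -> Prop) -> Prop) {FF : Filter F}
  (f g : T -> R) (a b : R) :
  filterlim f F (locally a) -> filterlim g F (locally b) ->
  filterlim (fun t => f t * g t) F (locally (a * b)).
Proof.
  intros Hf Hg; apply (filterlim_comp_2 _ _ _ Hf Hg).
  apply (filterlim_mult (K := R_AbsRing)).
Qed.

Lemma filterlim_sum {T} (F : (T -> Prop) -> Prop) {FF : Filter F}
  (f : nat -> T -> R) (a : nat -> R) (N : nat) :
  (forall n, (n <= N)%nat -> filterlim (f n) F (locally (a n))) ->
  filterlim (fun t => sum_f_R0 (fun n => f n t) N) F (locally (sum_f_R0 a N)).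
Proof.
  induction N as [|N IH]; intros Hf; simpl; [now apply Hf|].
  apply filterlim_Rplus; auto.
Qed.

Lemma filterlim_Rabs_le {T} (F : (T -> Prop) -> Prop) {FF : ProperFilter F}
  (f : T -> R) (a b : R) :
  F (fun t => Rabs (f t) <= b) -> filterlim f F (locally a) -> Rabs a <= b.
Proof.
  intros Hb Hf.
  apply (filterlim_le (F := F) (fun t => Rabs (f t)) (fun _ => b) (Rabs a) b Hb).
  - apply (filterlim_comp _ _ _ _ _ _ _ _ Hf).
    apply (filterlim_Rabs a).
  - apply filterlim_const.
Qed.

(** * Regularity and commutation of partial derivatives *)

Lemma uc_partials_uc (A : R -> R -> Prop) (M : nat) (w : R -> R -> R) :
  uc_partials A M w -> uniformly_continuous_on A w.
Proof. destruct M; now intros [Hw _]. Qed.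

Lemma uc_partials_partial_derive (A : R -> R -> Prop) (K m n : nat) (w : R -> R -> R) :
  uc_partials A (m + n + K) w -> uc_partials A K (partial_derive m n w).
Proof.
  revert K; induction m as [|m IHm].
  - induction n as [|n IHn]; intros K Hw; [exact Hw|].
    apply (IHn (S K)).
    now replace (0 + n + S K)%nat with (0 + S n + K)%nat by lia.
  - intros K Hw; apply (IHm (S K)).
    now replace (m + n + S K)%nat with (S m + n + K)%nat by lia.
Qed.

Lemma uc_partials_partial_derive_uc (A : R -> R -> Prop) (M m n : nat) (w : R -> R -> R) :
  uc_partials A M w -> (m + n <= M)%nat ->
  uniformly_continuous_on A (partial_derive m n w).
Proof.
  intros Hw Hmn; apply uc_partials_uc with (M - (m + n))%nat.
  apply uc_partials_partial_derive.
  now replace (m + n + (M - (m + n)))%nat with M by lia.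
Qed.

Lemma ex_derive_partial_derive (A : R -> R -> Prop) (M m n : nat) (w : R -> R -> R) (x y : R) :
  uc_partials A M w -> (m + n < M)%nat -> A x y ->
  ex_derive (fun t => partial_derive m n w t y) x /\
  ex_derive (fun t => partial_derive m n w x t) y.
Proof.
  intros Hw Hmn HA.
  assert (H : uc_partials A (S (M - S (m + n))) (partial_derive m n w)).
  { apply uc_partials_partial_derive.
    now replace (m + n + S (M - S (m + n)))%nat with M by lia. }
  now apply H.
Qed.

Lemma locally_open_interval (a b x : R) (P : R -> Prop) :
  a < x < b -> (forall t, a < t < b -> P t) -> locally x P.
Proof. intros [Ha Hb] HP; apply (locally_interval P x a b); simpl; auto. Qed.

Lemma rect_locally_2d (xa xb ya yb x y : R) (P : R -> R -> Prop) :
  rect xa xb ya yb x y -> (forall x y, rect xa xb ya yb x y -> P x y) ->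
  locally_2d P x y.
Proof.
  intros [[Hx1 Hx2] [Hy1 Hy2]] HP.
  assert (Hd : 0 < Rmin (Rmin (x - xa) (xb - x)) (Rmin (y - ya) (yb - y))).
  { repeat apply Rmin_pos; lra. }
  exists (mkposreal _ Hd); simpl; intros u v Hu Hv.
  assert (H1 := Rmin_l (Rmin (x - xa) (xb - x)) (Rmin (y - ya) (yb - y))).
  assert (H2 := Rmin_r (Rmin (x - xa) (xb - x)) (Rmin (y - ya) (yb - y))).
  assert (H3 := Rmin_l (x - xa) (xb - x)); assert (H4 := Rmin_r (x - xa) (xb - x)).
  assert (H5 := Rmin_l (y - ya) (yb - y)); assert (H6 := Rmin_r (y - ya) (yb - y)).
  apply Rabs_def2 in Hu, Hv.
  apply HP; split; lra.
Qed.

Lemma uniformly_continuous_continuity_2d_pt (xa xb ya yb x y : R) (w : R -> R -> R) :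
  uniformly_continuous_on (rect xa xb ya yb) w -> rect xa xb ya yb x y ->
  continuity_2d_pt w x y.
Proof.
  intros Hw Hxy eps; destruct (Hw eps) as [delta Hd].
  apply locally_2d_impl with (2 := rect_locally_2d _ _ _ _ _ _
    (fun u v => rect xa xb ya yb u v) Hxy (fun _ _ H => H)).
  exists delta; intros u v Hu Hv Huv; now apply Hd.
Qed.

Lemma dy_dx (xa xb ya yb x y : R) (M : nat) (w : R -> R -> R) :
  uc_partials (rect xa xb ya yb) (S (S M)) w -> rect xa xb ya yb x y ->
  dy (dx w) x y = dx (dy w) x y.
Proof.
  intros [_ [Hd [[_ [Hdx [_ Hyx]]] [_ [Hdy [Hxy _]]]]]] HA.
  symmetry; apply Schwarz.
  - apply rect_locally_2d with (1 := HA); intros u v Huv.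
    exact (conj (proj1 (Hd u v Huv)) (conj (proj2 (Hd u v Huv))
      (conj (proj1 (Hdy u v Huv)) (proj2 (Hdx u v Huv))))).
  - apply uniformly_continuous_continuity_2d_pt with (2 := HA).
    exact (uc_partials_uc _ _ _ Hxy).
  - apply uniformly_continuous_continuity_2d_pt with (2 := HA).
    exact (uc_partials_uc _ _ _ Hyx).
Qed.

Lemma dx_ext (xa xb ya yb x y : R) (v w : R -> R -> R) :
  (forall x y, rect xa xb ya yb x y -> v x y = w x y) -> rect xa xb ya yb x y ->
  dx v x y = dx w x y.
Proof.
  intros Hvw [Hx Hy]; apply Derive_ext_loc, locally_open_interval with (1 := Hx).
  intros t Ht; apply Hvw; now split.
Qed.

Lemma dy_ext (xa xb ya yb x y : R) (v w : R -> R -> R) :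
  (forall x y, rect xa xb ya yb x y -> v x y = w x y) -> rect xa xb ya yb x y ->
  dy v x y = dy w x y.
Proof.
  intros Hvw [Hx Hy]; apply Derive_ext_loc, locally_open_interval with (1 := Hy).
  intros t Ht; apply Hvw; now split.
Qed.

(** [partial_derive] differentiates in [y] first and in [x] afterwards, so a further [y]-derivative
    has to pass the [m] derivatives in [x], one application of Schwarz's theorem for each. *)
Lemma dy_partial_derive (xa xb ya yb : R) (M m n : nat) (w : R -> R -> R) :
  uc_partials (rect xa xb ya yb) M w -> (m + n < M)%nat ->
  forall x y, rect xa xb ya yb x y ->
  dy (partial_derive m n w) x y = partial_derive m (S n) w x y.
Proof.
  intros Hw; induction m as [|m IHm]; intros Hmn x y HA; [reflexivity|].
  change (dy (dx (partial_derive m n w)) x y = dx (partial_derive m (S n) w) x y).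
  rewrite (dy_dx xa xb ya yb x y (M - S (S (m + n)))); trivial.
  - apply (dx_ext xa xb ya yb); trivial.
    intros; apply IHm; trivial; lia.
  - apply uc_partials_partial_derive.
    now replace (m + n + S (S (M - S (S (m + n)))))%nat with M by lia.
Qed.

(** * The differential equation for higher derivatives and boundary limits *)

(** The equation is differentiated [n] times in [y] and then [m] times in [x], the order built into
    [partial_derive]; only the [y]-steps have to commute derivatives. *)
Lemma poisson_partial_derive (xa xb ya yb c : R) (M : nat) (u f : R -> R -> R) :
  uc_partials (rect xa xb ya yb) (M + 2) u -> uc_partials (rect xa xb ya yb) M f ->
  (forall x y, rect xa xb ya yb x y -> dx (dx u) x y = - dy (dy u) x y - f x y / c) ->
  forall m n, (m + n <= M)%nat -> forall x y, rect xa xb ya yb x y ->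
  partial_derive (m + 2) n u x y =
    - partial_derive m (n + 2) u x y - partial_derive m n f x y / c.
Proof.
  intros Hu Hf Hpde m n; revert m.
  assert (Hy : forall k, (k <= M)%nat -> forall x y, rect xa xb ya yb x y ->
    partial_derive 2 k u x y =
      - partial_derive 0 (k + 2) u x y - partial_derive 0 k f x y / c).
  { induction k as [|k IHk]; intros Hk x y HA; [now apply Hpde|].
    rewrite <- (dy_partial_derive _ _ _ _ (M + 2) 2 k u Hu ltac:(lia) x y HA).
    rewrite (dy_ext xa xb ya yb x y _ (fun x y =>
      - partial_derive 0 (k + 2) u x y - partial_derive 0 k f x y / c)); trivial;
      [| intros; apply IHk; trivial; lia].
    destruct (ex_derive_partial_derive _ _ 0 (k + 2) u x y Hu ltac:(lia) HA) as [_ Hdu].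
    destruct (ex_derive_partial_derive _ _ 0 k f x y Hf ltac:(lia) HA) as [_ Hdf].
    apply is_derive_unique.
    apply (is_derive_minus (K := R_AbsRing) (V := R_NormedModule)).
    - apply (is_derive_opp (K := R_AbsRing) (V := R_NormedModule)).
      now apply Derive_correct.
    - unfold Rdiv.
      apply (is_derive_ext (fun t => scal (/ c) (partial_derive 0 k f x t))).
      { intros t; apply Rmult_comm. }
      rewrite Rmult_comm.
      apply (is_derive_scal (fun t => partial_derive 0 k f x t)).
      now apply Derive_correct. }
  induction m as [|m IHm]; intros Hmn x y HA; [now apply Hy|].
  change (dx (partial_derive (m + 2) n u) x y =
    - partial_derive (S m) (n + 2) u x y - partial_derive (S m) n f x y / c).
  rewrite (dx_ext xa xb ya yb x y _ (fun x y =>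
      - partial_derive m (n + 2) u x y - partial_derive m n f x y / c)); trivial;
      [| intros; apply IHm; trivial; lia].
  destruct (ex_derive_partial_derive _ _ m (n + 2) u x y Hu ltac:(lia) HA) as [Hdu _].
  destruct (ex_derive_partial_derive _ _ m n f x y Hf ltac:(lia) HA) as [Hdf _].
  apply is_derive_unique.
  apply (is_derive_minus (K := R_AbsRing) (V := R_NormedModule)).
  - apply (is_derive_opp (K := R_AbsRing) (V := R_NormedModule)).
    now apply Derive_correct.
  - unfold Rdiv.
    apply (is_derive_ext (fun t => scal (/ c) (partial_derive m n f t y))).
    { intros t; apply Rmult_comm. }
    rewrite Rmult_comm.
    apply (is_derive_scal (fun t => partial_derive m n f t y)).
    now apply Derive_correct.
Qed.

Lemma limit_from_poisson (xa xb ya yb c : R) (M m n : nat) (u f : R -> R -> R) (x y : R) :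
  uc_partials (rect xa xb ya yb) (M + 2) u -> uc_partials (rect xa xb ya yb) M f ->
  (forall x y, rect xa xb ya yb x y -> dx (dx u) x y = - dy (dy u) x y - f x y / c) ->
  (m + n <= M)%nat -> xa < xb -> ya < yb -> clrect xa xb ya yb x y ->
  limit_from (rect xa xb ya yb) (partial_derive (m + 2) n u) x y =
    - limit_from (rect xa xb ya yb) (partial_derive m (n + 2) u) x y
    - limit_from (rect xa xb ya yb) (partial_derive m n f) x y / c.
Proof.
  intros Hu Hf Hpde Hmn Hab Hab' Hxy.
  rewrite (limit_from_ext _ _ (fun x y =>
    - partial_derive m (n + 2) u x y - partial_derive m n f x y / c))
    by now apply (poisson_partial_derive _ _ _ _ c M).
  set (A := rect xa xb ya yb) in *.
  assert (PF := within_rect_proper _ _ _ _ _ _ Hxy Hab Hab').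
  apply (iota_filterlim_locally (V := R_CompleteNormedModule)).
  assert (FF : Filter (within (fun z : R * R => A (fst z) (snd z)) (locally (x, y))))
    by apply PF.
  apply filterlim_ext with (fun z : R * R =>
    (-1) * partial_derive m (n + 2) u (fst z) (snd z)
    + (- / c) * partial_derive m n f (fst z) (snd z)).
  { intros z; unfold Rdiv; ring. }
  match goal with |- filterlim _ _ (locally (- ?a - ?b / c)) =>
    replace (- a - b / c) with ((-1) * a + (- / c) * b) by (unfold Rdiv; ring) end.
  apply (filterlim_Rplus _ (FF := FF)); apply (filterlim_Rmult _ (FF := FF));
    try apply filterlim_const; apply uniformly_continuous_filterlim; trivial;
    eapply uc_partials_partial_derive_uc; eauto; lia.
Qed.

(** * Tangential derivatives of boundary limits *)

(** On each vertical line inside the rectangle, the mean value theorem writes the difference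
    quotient minus [dy w] as a difference of two values of [dy w]. Uniform continuity bounds it
    uniformly in [x], so the bound survives the limit onto a vertical edge. *)
Lemma limit_from_is_derive (xa xb ya yb x y : R) (w : R -> R -> R) :
  uc_partials (rect xa xb ya yb) 1 w -> xa < xb -> xa <= x <= xb -> ya < y < yb ->
  is_derive (fun t => limit_from (rect xa xb ya yb) w x t) y
    (limit_from (rect xa xb ya yb) (dy w) x y).
Proof.
  intros [Hw [Hd [_ [Hdy _]]]] Hab Hx Hy.
  set (c := (xa + xb) / 2).
  assert (Hlim : forall v t, uniformly_continuous_on (rect xa xb ya yb) v ->
    ya < t < yb -> filterlim (fun s => v (seg x c s) t) (at_right 0)
      (locally (limit_from (rect xa xb ya yb) v x t))).
  { intros v t Hv Ht.
    apply filterlim_ext with (fun s => v (seg x c s) (seg t t s)).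
    { intros s; f_equal; unfold seg; ring. }
    apply limit_from_seg; trivial; split; trivial; unfold c; lra. }
  apply is_derive_Reals; intros eps Heps.
  (* Strict inequalities become weak ones in the limit; working with [eps / 2] recovers the strict
     bound by [eps]. *)
  destruct (Hdy (pos_div_2 (mkposreal eps Heps))) as [delta Hdelta].
  assert (Hr : 0 < Rmin delta (Rmin (y - ya) (yb - y))).
  { repeat apply Rmin_pos; try lra; apply cond_pos. }
  exists (mkposreal _ Hr); simpl; intros h Hh0 Hh.
  assert (Hh1 : Rabs h < delta) by (eapply Rlt_le_trans; [exact Hh | apply Rmin_l]).
  assert (Hh2 : ya < y + h < yb).
  { assert (H1 := Rmin_r delta (Rmin (y - ya) (yb - y))).
    assert (H2 := Rmin_l (y - ya) (yb - y)); assert (H3 := Rmin_r (y - ya) (yb - y)).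
    apply Rabs_def2 in Hh; lra. }
  apply Rle_lt_trans with (eps / 2); [| lra].
  apply (filterlim_Rabs_le (at_right 0)
    (fun s => (w (seg x c s) (y + h) + (-1) * w (seg x c s) y) * / h
              + (-1) * dy w (seg x c s) y)).
  - apply (filter_imp (fun t => 0 < t < 1)); [| apply at_right_0_lt; lra].
    intros t Ht.
    assert (Hs : xa < seg x c t < xb) by (apply seg_in; unfold c; trivial; lra).
    destruct (MVT_gen (fun z => w (seg x c t) z) y (y + h) (fun z => dy w (seg x c t) z))
      as [z [Hz Heq]].
    + intros z Hz; apply Derive_correct, Hd; split; trivial.
      revert Hz; unfold Rmin, Rmax; destruct (Rle_dec y (y + h)); lra.
    + intros z Hz; apply continuity_pt_filterlim.
      apply (ex_derive_continuous (fun z => w (seg x c t) z)), Hd; split; trivial.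
      revert Hz; unfold Rmin, Rmax; destruct (Rle_dec y (y + h)); lra.
    + replace ((w (seg x c t) (y + h) + -1 * w (seg x c t) y) * / h
              + -1 * dy w (seg x c t) y)
        with (dy w (seg x c t) z - dy w (seg x c t) y).
      2:{ replace (w (seg x c t) (y + h) + -1 * w (seg x c t) y)
            with (dy w (seg x c t) z * (y + h - y)) by lra; field; trivial. }
      assert (Hzy : Rabs (z - y) <= Rabs h).
      { revert Hz; unfold Rmin, Rmax, Rabs.
        destruct (Rle_dec y (y + h)), (Rcase_abs (z - y)), (Rcase_abs h); lra. }
      left; apply (Hdelta _ _ _ _).
      * split; trivial.
        revert Hz; unfold Rmin, Rmax; destruct (Rle_dec y (y + h)); lra.
      * now split.
      * replace (seg x c t - seg x c t) with 0 by ring.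
        rewrite Rabs_R0; apply cond_pos.
      * lra.
  - match goal with |- filterlim _ _ (locally ((?a - ?b) / h - ?d)) =>
      replace ((a - b) / h - d) with ((a + (-1) * b) * / h + (-1) * d)
        by (field; trivial) end.
    repeat first [apply (filterlim_Rplus (at_right 0)) | apply (filterlim_Rmult (at_right 0)) | apply filterlim_const
                 | apply Hlim; trivial].
Qed.

(** * Taylor's formula with Lipschitz derivatives of top order *)

Lemma is_derive_taylor_sum (a : nat -> R) (n : nat) (s : R) :
  is_derive (fun s => sum_f_R0 (fun k => a k * (s ^ k / INR (fact k))) (S n)) s
    (sum_f_R0 (fun k => a (S k) * (s ^ k / INR (fact k))) n).
Proof.
  assert (Hterm : forall k, is_derive (fun s => a (S k) * (s ^ S k / INR (fact (S k)))) s
    (a (S k) * (s ^ k / INR (fact k)))).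
  { intros k.
    assert (H1 := INR_fact_neq_0 k); assert (H2 := not_0_INR (S k) ltac:(lia)).
    auto_derive; trivial.
    change (match k with 0%nat => 1 | S _ => INR k + 1 end) with (INR (S k)).
    change (fact k + k * fact k)%nat with (S k * fact k)%nat.
    rewrite mult_INR; field; split; trivial. }
  induction n as [|n IHn].
  - apply is_derive_ext with (fun s => plus (a 0%nat) (a 1%nat * (s ^ 1 / INR (fact 1)))).
    { intros t; simpl; unfold plus; simpl; field. }
    replace (sum_f_R0 _ 0) with (plus 0 (a 1%nat * (s ^ 0 / INR (fact 0))))
      by (simpl; unfold plus; simpl; ring).
    apply (is_derive_plus (K := R_AbsRing) (V := R_NormedModule)).
    + apply (is_derive_const (K := R_AbsRing) (V := R_NormedModule)).
    + apply Hterm.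
  - apply (is_derive_plus (K := R_AbsRing) (V := R_NormedModule)); [exact IHn | apply Hterm].
Qed.

(** The remainder vanishes at [s = 0] and its derivative is the remainder of one order less for
    [Derive g], so the mean value theorem gains one factor [Rabs s] at each induction step. The
    factorial of the sharp bound is given up. *)
Lemma taylor_lipschitz (g : R -> R) (n : nat) (a b L x s : R) :
  0 <= L ->
  (forall k t, (k < n)%nat -> a < t < b -> ex_derive (Derive_n g k) t) ->
  (forall t t', a < t < b -> a < t' < b ->
     Rabs (Derive_n g n t - Derive_n g n t') <= L * Rabs (t - t')) ->
  a < x < b -> a < x + s < b ->
  Rabs (g (x + s) - sum_f_R0 (fun k => Derive_n g k x * (s ^ k / INR (fact k))) n)
    <= L * Rabs s ^ S n.
Proof.
  intros HL; revert g s; induction n as [|n IHn]; intros g s Hd Hlip Hx Hxs.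
  { simpl; specialize (Hlip _ _ Hxs Hx); simpl in Hlip.
    replace (x + s - x) with s in Hlip by ring.
    replace (g x * (1 / 1)) with (g x) by field; lra. }
  assert (Hcomp : forall k t, Derive_n (Derive g) k t = Derive_n g (S k) t).
  { intros k t; rewrite <- (Nat.add_1_r k).
    exact (Derive_n_comp g k 1 t). }
  set (r := fun s => g (x + s) - sum_f_R0 (fun k => Derive_n g k x * (s ^ k / INR (fact k))) (S n)).
  set (r' := fun s => Derive g (x + s) -
     sum_f_R0 (fun k => Derive_n g (S k) x * (s ^ k / INR (fact k))) n).
  assert (Hr : forall t, a < x + t < b -> is_derive r t (r' t)).
  { intros t Ht.
    apply (is_derive_minus (K := R_AbsRing) (V := R_NormedModule)).
    - replace (Derive g (x + t)) with (1 * Derive g (x + t)) by ring.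
      apply (is_derive_comp g (fun t => x + t)).
      + apply Derive_correct, (Hd 0%nat); trivial; lia.
      + auto_derive; trivial.
    - apply (is_derive_taylor_sum (fun k => Derive_n g k x)). }
  assert (Hbetween : forall t, Rmin 0 s <= t <= Rmax 0 s -> a < x + t < b /\ Rabs t <= Rabs s).
  { intros t Ht; revert Ht; unfold Rmin, Rmax, Rabs.
    destruct (Rle_dec 0 s), (Rcase_abs t), (Rcase_abs s); lra. }
  destruct (MVT_gen r 0 s r') as [t [Ht Heq]].
  { intros t Ht; apply Hr, Hbetween; lra. }
  { intros t Ht; apply continuity_pt_filterlim.
    apply (ex_derive_continuous r); exists (r' t); now apply Hr, Hbetween. }
  assert (Hr0 : r 0 = 0).
  (* At 0 only the term [k = 0] survives, because [0 ^ 0 = 1]. *)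
  { unfold r; rewrite decomp_sum by lia; simpl pred.
    rewrite (sum_eq _ (fun _ => 0)).
    - rewrite sum_cte; simpl; rewrite Rplus_0_r; field.
    - intros k _; simpl; unfold Rdiv; ring. }
  destruct (Hbetween t Ht) as [Hxt Hts].
  change (Rabs (r s) <= L * Rabs s ^ S (S n)).
  replace (r s) with (r' t * s) by lra.
  rewrite Rabs_mult; simpl.
  assert (Hr't : Rabs (r' t) <= L * Rabs t ^ S n).
  { unfold r'; rewrite (sum_eq _ (fun k => Derive_n (Derive g) k x * (t ^ k / INR (fact k))))
      by (intros; now rewrite Hcomp).
    apply IHn; trivial.
    - intros k z Hk Hz.
      apply ex_derive_ext with (Derive_n g (S k)); [intros; now rewrite Hcomp|].
      apply Hd; trivial; lia.
    - intros; rewrite !Hcomp; now apply Hlip. }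
  assert (Hpow : Rabs t ^ S n <= Rabs s ^ S n).
  { apply pow_incr; split; trivial; apply Rabs_pos. }
  apply Rle_trans with (L * Rabs s ^ S n * Rabs s); [|simpl; right; ring].
  apply Rmult_le_compat_r; [apply Rabs_pos|].
  apply Rle_trans with (1 := Hr't), Rmult_le_compat_l; trivial.
Qed.

(** The nesting mirrors an expansion in [y] whose [n]-th coefficient is itself expanded in [x] to
    degree [M - n], for total degree [M]. *)
Definition taylor2 (M : nat) (d : nat -> nat -> R) (s t : R) : R :=
  sum_f_R0 (fun n => sum_f_R0 (fun m =>
    d m n * (s ^ m / INR (fact m))) (M - n) * (t ^ n / INR (fact n))) M.

Lemma pow_div_fact_le (t h : R) (n : nat) :
  Rabs t <= h -> Rabs (t ^ n / INR (fact n)) <= h ^ n.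
Proof.
  intros Ht.
  assert (Hf : 1 <= INR (fact n)) by (apply (le_INR 1), lt_O_fact).
  unfold Rdiv; rewrite Rabs_mult, <- RPow_abs.
  rewrite (Rabs_pos_eq (/ INR (fact n))) by (left; apply Rinv_0_lt_compat; lra).
  rewrite <- (Rmult_1_r (h ^ n)).
  apply Rmult_le_compat.
  - apply pow_le, Rabs_pos.
  - left; apply Rinv_0_lt_compat; lra.
  - apply pow_incr; split; trivial; apply Rabs_pos.
  - rewrite <- Rinv_1; apply Rinv_le_contravar; lra.
Qed.

(** Two applications of the one-variable formula: first in [y] on the line through [x + s], then in
    [x] for each coefficient at height [y]. A rectangle contains all the segments involved. *)
Lemma taylor2_lipschitz (xa xb ya yb : R) (M : nat) (u : R -> R -> R) (L x y s t h : R) :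
  uc_partials (rect xa xb ya yb) M u -> 0 <= L ->
  (forall m n, (m + n = M)%nat -> forall x y x' y',
     rect xa xb ya yb x y -> rect xa xb ya yb x' y' ->
     Rabs (partial_derive m n u x y - partial_derive m n u x' y')
       <= L * (Rabs (x - x') + Rabs (y - y'))) ->
  rect xa xb ya yb x y -> rect xa xb ya yb (x + s) (y + t) ->
  Rabs s <= h -> Rabs t <= h ->
  Rabs (u (x + s) (y + t) - taylor2 M (fun m n => partial_derive m n u x y) s t)
    <= INR (M + 2) * L * h ^ S M.
Proof.
  intros Hu HL Hlip [Hx Hy] [Hxs Hyt] Hs Ht.
  set (U := sum_f_R0 (fun n => partial_derive 0 n u (x + s) y * (t ^ n / INR (fact n))) M).
  assert (Hh : 0 <= h) by (eapply Rle_trans; [apply Rabs_pos | exact Hs]).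
  assert (H1 : Rabs (u (x + s) (y + t) - U) <= L * h ^ S M).
  { apply Rle_trans with (L * Rabs t ^ S M).
    - apply (taylor_lipschitz (u (x + s)) M ya yb); trivial.
      + intros k z Hk Hz.
        exact (proj2 (ex_derive_partial_derive _ M 0 k u (x + s) z Hu Hk (conj Hxs Hz))).
      + intros z z' Hz Hz'.
        assert (H := Hlip 0%nat M eq_refl (x + s) z (x + s) z'
          (conj Hxs Hz) (conj Hxs Hz')).
        replace (x + s - (x + s)) with 0 in H by ring.
        rewrite Rabs_R0, Rplus_0_l in H; exact H.
    - apply Rmult_le_compat_l; trivial; apply pow_incr; split; trivial; apply Rabs_pos. }
  assert (H2 : Rabs (U - taylor2 M (fun m n => partial_derive m n u x y) s t)
               <= INR (S M) * (L * h ^ S M)).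
  { unfold U, taylor2; rewrite <- minus_sum, Rmult_comm, <- sum_cte.
    eapply Rle_trans; [apply Rsum_abs|].
    apply sum_Rle; intros n Hn.
    rewrite <- Rmult_minus_distr_r, Rabs_mult.
    (* The first power bounds the remainder in [x] of the [n]-th coefficient, the second the
       monomial in [t]. *)
    replace (h ^ S M) with (h ^ S (M - n) * h ^ n)
      by (rewrite <- pow_add; f_equal; lia).
    rewrite <- Rmult_assoc.
    apply Rmult_le_compat; try apply Rabs_pos; [| now apply pow_div_fact_le].
    apply Rle_trans with (L * Rabs s ^ S (M - n)).
    - apply (taylor_lipschitz (fun z => partial_derive 0 n u z y) (M - n) xa xb); trivial.
      + intros k z Hk Hz.
        exact (proj1 (ex_derive_partial_derive _ M k n u z y Hu ltac:(lia) (conj Hz Hy))).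
      + intros z z' Hz Hz'.
        assert (H := Hlip (M - n)%nat n ltac:(lia) z y z' y (conj Hz Hy) (conj Hz' Hy)).
        replace (y - y) with 0 in H by ring.
        rewrite Rabs_R0, Rplus_0_r in H; exact H.
    - apply Rmult_le_compat_l; trivial; apply pow_incr; split; trivial; apply Rabs_pos. }
  (* One error comes from the expansion in [y] and [M + 1] errors come from the expansions of its
     coefficients. *)
  replace (INR (M + 2)) with (1 + INR (S M)) by (rewrite plus_INR, S_INR; simpl; ring).
  replace (u (x + s) (y + t) - taylor2 M (fun m n => partial_derive m n u x y) s t)
    with ((u (x + s) (y + t) - U) +
          (U - taylor2 M (fun m n => partial_derive m n u x y) s t)) by ring.
  eapply Rle_trans; [apply Rabs_triang | lra].
Qed.

Lemma filterlim_scaled_pow (s : R) (m : nat) :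
  filterlim (fun r => ((1 - r) * s) ^ m / INR (fact m)) (at_right 0)
    (locally (s ^ m / INR (fact m))).
Proof.
  apply (filterlim_filter_le_1 _ (filter_le_within (fun r => 0 < r))).
  replace (s ^ m) with (((1 - 0) * s) ^ m) by (f_equal; ring).
  apply (ex_derive_continuous (fun r => ((1 - r) * s) ^ m / INR (fact m))).
  auto_derive; trivial.
Qed.

(** Both points are contracted towards the centre of the rectangle. This puts them in its interior
    and multiplies the increments by [1 - r], so the same [h] bounds them, and [r] then tends to
    0. *)
Lemma limit_from_taylor2 (xa xb ya yb : R) (M : nat) (u : R -> R -> R) (L x y s t h : R) :
  uc_partials (rect xa xb ya yb) M u -> 0 <= L ->
  (forall m n, (m + n = M)%nat -> forall x y x' y',
     rect xa xb ya yb x y -> rect xa xb ya yb x' y' ->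
     Rabs (partial_derive m n u x y - partial_derive m n u x' y')
       <= L * (Rabs (x - x') + Rabs (y - y'))) ->
  xa < xb -> ya < yb ->
  clrect xa xb ya yb x y -> clrect xa xb ya yb (x + s) (y + t) ->
  Rabs s <= h -> Rabs t <= h ->
  Rabs (limit_from (rect xa xb ya yb) u (x + s) (y + t)
        - taylor2 M (fun m n => limit_from (rect xa xb ya yb) (partial_derive m n u) x y) s t)
    <= INR (M + 2) * L * h ^ S M.
Proof.
  intros Hu HL Hlip Hab Hab' Hxy Hst Hs Ht.
  set (cx := (xa + xb) / 2); set (cy := (ya + yb) / 2).
  assert (Hc : rect xa xb ya yb cx cy) by (unfold cx, cy; split; lra).
  apply (filterlim_Rabs_le (at_right 0) (fun r =>
    u (seg (x + s) cx r) (seg (y + t) cy r) + (-1) *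
    taylor2 M (fun m n => partial_derive m n u (seg x cx r) (seg y cy r))
      ((1 - r) * s) ((1 - r) * t))).
  - apply (filter_imp (fun r => 0 < r < 1)); [| apply at_right_0_lt; lra].
    intros r Hr.
    assert (Habs : forall z, Rabs z <= h -> Rabs ((1 - r) * z) <= h).
    { intros z Hz; rewrite Rabs_mult, (Rabs_pos_eq (1 - r)) by lra.
      assert (H := Rabs_pos z); nra. }
    assert (Hseg : forall z z' c, seg (z + z') c r = seg z c r + (1 - r) * z')
      by (intros; unfold seg; ring).
    assert (Hin : rect xa xb ya yb (seg (x + s) cx r) (seg (y + t) cy r)).
    { destruct Hst, Hc; split; now apply seg_in. }
    rewrite !Hseg in Hin |- *.
    match goal with |- Rabs (?a + -1 * ?b) <= _ =>
      replace (a + -1 * b) with (a - b) by ring end.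
    apply (taylor2_lipschitz xa xb ya yb); auto.
    destruct Hxy, Hc; split; now apply seg_in.
  - match goal with |- filterlim _ _ (locally (?a - ?b)) =>
      replace (a - b) with (a + (-1) * b) by ring end.
    apply (filterlim_Rplus (at_right 0)).
    + apply limit_from_seg; trivial; now apply uc_partials_uc with M.
    + apply (filterlim_Rmult (at_right 0)); [apply filterlim_const|].
      unfold taylor2.
      apply (filterlim_sum (at_right 0) (fun n r => _)); intros n Hn.
      apply (filterlim_Rmult (at_right 0)); [| apply filterlim_scaled_pow].
      apply (filterlim_sum (at_right 0) (fun m r => _)); intros m Hm.
      apply (filterlim_Rmult (at_right 0)); [| apply filterlim_scaled_pow].
      apply limit_from_seg; trivial.
      apply uc_partials_partial_derive_uc with M; trivial; lia.
Qed.

(** * Jump conditions in terms of one-sided limits of derivatives *)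

(** Differentiation along the interface commutes with the one-sided limits. For [phi P1] one takes
    [m = 0] and weights 1; for [psi P1], [m = 1] and the coefficients of the two sides. *)
Lemma Derive_n_limit_from_jump (xa xb xc ya yb c1 c2 : R) (M m n : nat)
  (u : R -> R -> R) (chi : R -> R) :
  xa < xc < xb ->
  uc_partials (rect xa xc ya yb) M u -> uc_partials (rect xc xb ya yb) M u ->
  (forall t, ya < t < yb -> chi t =
     c2 * limit_from (rect xc xb ya yb) (partial_derive m 0 u) xc t
     - c1 * limit_from (rect xa xc ya yb) (partial_derive m 0 u) xc t) ->
  (m + n <= M)%nat -> forall t, ya < t < yb -> Derive_n chi n t =
     c2 * limit_from (rect xc xb ya yb) (partial_derive m n u) xc t
     - c1 * limit_from (rect xa xc ya yb) (partial_derive m n u) xc t.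
Proof.
  intros Hxc Hu1 Hu2 Hchi; induction n as [|n IHn]; intros Hmn t Ht; [now apply Hchi|].
  simpl Derive_n.
  rewrite (Derive_ext_loc _ (fun t =>
    c2 * limit_from (rect xc xb ya yb) (partial_derive m n u) xc t
    - c1 * limit_from (rect xa xc ya yb) (partial_derive m n u) xc t)).
  2:{ apply locally_open_interval with (1 := Ht); intros; apply IHn; trivial; lia. }
  apply is_derive_unique.
  assert (Hd : forall xa xb, xa < xb -> xa <= xc <= xb ->
    uc_partials (rect xa xb ya yb) M u ->
    is_derive (fun t => limit_from (rect xa xb ya yb) (partial_derive m n u) xc t) t
      (limit_from (rect xa xb ya yb) (partial_derive m (S n) u) xc t)).
  { intros za zb Hz Hz' Hu.
    rewrite <- (limit_from_ext (rect za zb ya yb) (dy (partial_derive m n u))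
      (partial_derive m (S n) u) _ _
      (dy_partial_derive _ _ _ _ M m n u Hu ltac:(lia))).
    apply limit_from_is_derive; trivial.
    destruct (uc_partials_partial_derive (rect za zb ya yb) (S (M - S (m + n))) m n u) as [H0 [H1 [H2 H3]]].
    { now replace (m + n + S (M - S (m + n)))%nat with M by lia. }
    split; trivial; split; trivial.
    split; split; trivial; eapply uc_partials_uc; eassumption. }
  apply (is_derive_minus (K := R_AbsRing) (V := R_NormedModule)).
  - apply (is_derive_scal (fun t =>
      limit_from (rect xc xb ya yb) (partial_derive m n u) xc t)); apply Hd; trivial; lra.
  - apply (is_derive_scal (fun t =>
      limit_from (rect xa xc ya yb) (partial_derive m n u) xc t)); apply Hd; trivial; lra.
Qed.

(** [jump] takes limits along a horizontal line, [limit_from] over a whole rectangle. Both are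
    followed along the same horizontal segment and agree by uniqueness of limits. For the flux, [z]
    is [a] times [dx u] and [w] is [dx u]. *)
Lemma jump_limit_from (xa xb xc ya yb c1 c2 y v : R) (w z : R -> R -> R) :
  xa < xc < xb -> ya < y < yb ->
  uniformly_continuous_on (rect xa xc ya yb) w ->
  uniformly_continuous_on (rect xc xb ya yb) w ->
  (forall x, xa < x < xc -> z x y = c1 * w x y) ->
  (forall x, xc < x < xb -> z x y = c2 * w x y) ->
  jump (fun t => z t y) xc v ->
  v = c2 * limit_from (rect xc xb ya yb) w xc y
      - c1 * limit_from (rect xa xc ya yb) w xc y.
Proof.
  intros Hxc Hy Hw1 Hw2 Hz1 Hz2 [r [l [Hr [Hl <-]]]].
  assert (Hlim : forall xa xb c cx, xa <= xc <= xb -> xa < cx < xb ->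
    uniformly_continuous_on (rect xa xb ya yb) w ->
    (forall x, xa < x < xb -> z x y = c * w x y) ->
    filterlim (fun s => z (seg xc cx s) y) (at_right 0)
      (locally (c * limit_from (rect xa xb ya yb) w xc y))).
  { intros za zb c cx Hz Hcx Hw Hzw.
    apply filterlim_ext_loc with (fun s => c * w (seg xc cx s) (seg y y s)).
    - apply (filter_imp (fun s => 0 < s < 1)); [| apply at_right_0_lt; lra].
      intros s Hs; replace (seg y y s) with y by (unfold seg; ring).
      symmetry; apply Hzw, seg_in; trivial; lra.
    - apply (filterlim_Rmult (at_right 0)); [apply filterlim_const|].
      apply limit_from_seg; trivial; split; trivial; lra. }
  assert (Hseg : forall cx, filterlim (seg xc cx) (at_right 0) (locally xc)).
  { intros cx; apply (filterlim_filter_le_1 _ (filter_le_within (fun r => 0 < r))).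
    replace xc with (seg xc cx 0) at 2 by (unfold seg; ring).
    apply (ex_derive_continuous (seg xc cx)); unfold seg; auto_derive; trivial. }
  assert (H0 : at_right 0 (fun s => 0 < s < 1)) by (apply at_right_0_lt; lra).
  f_equal.
  - set (cx := (xc + xb) / 2).
    apply (filterlim_locally_unique (V := R_NormedModule) (F := at_right 0)
      (fun s => z (seg xc cx s) y)).
    + apply (filterlim_comp _ _ _ (seg xc cx) (fun t => z t y) _ (at_right xc)); trivial.
      intros P HP; apply filter_imp with (2 := filter_and _ _ H0 (Hseg cx _ HP)).
      intros s [Hs HPs]; apply HPs; unfold seg, cx; nra.
    + apply Hlim; trivial; unfold cx; lra.
  - set (cx := (xa + xc) / 2).
    apply (filterlim_locally_unique (V := R_NormedModule) (F := at_right 0)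
      (fun s => z (seg xc cx s) y)).
    + apply (filterlim_comp _ _ _ (seg xc cx) (fun t => z t y) _ (at_left xc)); trivial.
      intros P HP; apply filter_imp with (2 := filter_and _ _ H0 (Hseg cx _ HP)).
      intros s [Hs HPs]; apply HPs; unfold seg, cx; nra.
    + apply Hlim; trivial; unfold cx; lra.
Qed.

(** * Reduction of the Taylor polynomial to the polynomials [G] and [H] *)

(** Each use of the equation trades two [x]-derivatives for two [y]-derivatives with a change of
    sign, until at most one [x]-derivative is left. The signs accumulate to [(-1) ^ l] in [G], and
    the source terms released on the way collect into [H]. *)
Lemma taylor2_poisson (c : R) (d e : nat -> nat -> R) (s t : R) :
  (forall m n, (m + n <= 5)%nat -> d (m + 2)%nat n = - d m (n + 2)%nat - e m n / c) ->
  taylor2 7 d s t =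
    sum_f_R0 (fun n => d 0%nat n * G 0 n s t) 7
    + sum_f_R0 (fun n => d 1%nat n * G 1 n s t) 6
    + / c * sum_Lambda 5 (fun m n => e m n * H m n s t).
Proof.
  intros Hd; unfold taylor2, G, H, sum_Lambda, sum_f, Rdiv.
  (* The identity is linear in the products of inverse factorials, so these can
     stay abstract. *)
  assert (Hinv : exists q, forall k, / INR (fact k) = q k) by now exists (fun k => / INR (fact k)).
  destruct Hinv as [q Hq].
  cbv [sum_f_R0 Nat.add Nat.mul Nat.sub Nat.div Nat.divmod fst].
  rewrite !Rinv_mult, !Hq.
  assert (Hd' : forall m n, (m + n <= 5)%nat ->
    d (S (S m)) n = - d m (S (S n)) - e m n * / c).
  { intros m n Hmn; generalize (Hd m n Hmn).
    now replace (m + 2)%nat with (S (S m)) by lia;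
      replace (n + 2)%nat with (S (S n)) by lia. }
  rewrite !Hd' by lia.
  ring.
Qed.

(** The stencil is split by the side whose values it reads: column -1 here, columns 0 and 1 in
    [right_sum]. At [G] and [H] the left functional gives [calG] and [Hminus]; at [H] the right one
    gives [Hplus]. *)
Definition left_sum (C : Z -> Z -> R) (h : R) (v : R -> R -> R) : R :=
  sumZ [-1; 0; 1]%Z (fun l => C (-1)%Z l * v (- h) (IZR l * h)).

Definition right_sum (C : Z -> Z -> R) (h : R) (v : R -> R -> R) : R :=
  sumZ [0; 1]%Z (fun k => sumZ [-1; 0; 1]%Z (fun l =>
    C k l * v (IZR k * h) (IZR l * h))).

Definition linear_functional (Phi : (R -> R -> R) -> R) : Prop :=
  (forall v w, Phi (fun s t => v s t + w s t) = Phi v + Phi w) /\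
  (forall a v, Phi (fun s t => a * v s t) = a * Phi v).

Lemma left_sum_linear (C : Z -> Z -> R) (h : R) : linear_functional (left_sum C h).
Proof. split; intros; unfold left_sum, sumZ; simpl; ring. Qed.

Lemma right_sum_linear (C : Z -> Z -> R) (h : R) : linear_functional (right_sum C h).
Proof. split; intros; unfold right_sum, sumZ; simpl; ring. Qed.

Lemma linear_functional_sum (Phi : (R -> R -> R) -> R) (v : nat -> R -> R -> R) (N : nat) :
  linear_functional Phi ->
  Phi (fun s t => sum_f_R0 (fun n => v n s t) N) = sum_f_R0 (fun n => Phi (v n)) N.
Proof.
  intros [Hadd _]; induction N as [|N IHN]; [reflexivity|].
  simpl; rewrite <- IHN; apply Hadd.
Qed.

Lemma linear_functional_poisson (Phi : (R -> R -> R) -> R) (c : R) (d e : nat -> nat -> R) :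
  linear_functional Phi ->
  Phi (fun s t =>
      sum_f_R0 (fun n => d 0%nat n * G 0 n s t) 7
      + sum_f_R0 (fun n => d 1%nat n * G 1 n s t) 6
      + / c * sum_Lambda 5 (fun m n => e m n * H m n s t)) =
    sum_f_R0 (fun n => d 0%nat n * Phi (G 0 n)) 7
    + sum_f_R0 (fun n => d 1%nat n * Phi (G 1 n)) 6
    + / c * sum_Lambda 5 (fun m n => e m n * Phi (H m n)).
Proof.
  intros HPhi; destruct (HPhi) as [Hadd Hscal].
  rewrite !Hadd, Hscal; unfold sum_Lambda.
  rewrite !linear_functional_sum by trivial.
  f_equal; [f_equal|f_equal]; apply sum_eq; intros; try apply Hscal.
  rewrite linear_functional_sum by trivial.
  apply sum_eq; intros; apply Hscal.
Qed.

(** * The stencil on harmonic polynomials *)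

(** Factorials are evaluated to integer literals, so that [field] computes with numerals and not
    with unary sums. *)
Ltac eval_G :=
  cbv [calG right_sum G sumZ fold_right stencil sum_f_R0 Nat.add Nat.mul Nat.sub
       Nat.div Nat.divmod fst];
  rewrite ?INR_IZR_INZ;
  repeat match goal with |- context [Z.of_nat ?n] =>
    let v := eval vm_compute in (Z.of_nat n) in change (Z.of_nat n) with v end;
  field.

(** [G 0 n] is even in [x], so this is the vanishing of the full stencil on a harmonic polynomial of
    degree [n]. *)
Lemma stencil_G0 (alpha h : R) (n : nat) :
  (n <= 7)%nat -> calG (stencil alpha) h 0 n = - right_sum (stencil alpha) h (G 0 n).
Proof.
  intros Hn; do 8 (destruct n as [|n]; [eval_G |]); lia.
Qed.

(** [G 1 n] is odd in [x]: the middle column contributes nothing, and the left column has [alpha]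
    times the coefficients of the right one. *)
Lemma stencil_G1 (alpha h : R) (n : nat) :
  (n <= 6)%nat -> calG (stencil alpha) h 1 n = - alpha * right_sum (stencil alpha) h (G 1 n).
Proof.
  intros Hn; do 7 (destruct n as [|n]; [eval_G |]); lia.
Qed.

(** The absolute values of the coefficients add up to [6 * alpha + 14 * (1 + alpha) + 6 = 20 * (1 +
    alpha)]. *)
Lemma Lh_close (alpha B : R) (v T : Z -> Z -> R) :
  0 < alpha ->
  (forall k l, In k [-1; 0; 1]%Z -> In l [-1; 0; 1]%Z -> Rabs (v k l - T k l) <= B) ->
  Rabs (Lh (stencil alpha) v - Lh (stencil alpha) T) <= 20 * (1 + alpha) * B.
Proof.
  intros Ha Hv.
  assert (Hb : forall k l, In k [-1; 0; 1]%Z -> In l [-1; 0; 1]%Z ->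
    - B <= v k l - T k l <= B) by (intros; now apply Rabs_le_between, Hv).
  assert (H1 := Hb (-1)%Z (-1)%Z ltac:(simpl; tauto) ltac:(simpl; tauto)).
  assert (H2 := Hb (-1)%Z 0%Z ltac:(simpl; tauto) ltac:(simpl; tauto)).
  assert (H3 := Hb (-1)%Z 1%Z ltac:(simpl; tauto) ltac:(simpl; tauto)).
  assert (H4 := Hb 0%Z (-1)%Z ltac:(simpl; tauto) ltac:(simpl; tauto)).
  assert (H5 := Hb 0%Z 0%Z ltac:(simpl; tauto) ltac:(simpl; tauto)).
  assert (H6 := Hb 0%Z 1%Z ltac:(simpl; tauto) ltac:(simpl; tauto)).
  assert (H7 := Hb 1%Z (-1)%Z ltac:(simpl; tauto) ltac:(simpl; tauto)).
  assert (H8 := Hb 1%Z 0%Z ltac:(simpl; tauto) ltac:(simpl; tauto)).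
  assert (H9 := Hb 1%Z 1%Z ltac:(simpl; tauto) ltac:(simpl; tauto)).
  clear Hb Hv.
  unfold Lh, sumZ, stencil; simpl.
  apply Rabs_le; split; nra.
Qed.

(** This is where the formula for [rhs_F] comes from: it is exactly the stencil applied to the two
    Taylor polynomials. The two stencil identities make the normal and tangential coefficients enter
    only through the jumps [p] and [q]. *)
Lemma Lh_taylor2 (a1 a2 h : R) (d1 d2 e1 e2 : nat -> nat -> R) (p q : nat -> R) :
  a1 <> 0 -> a2 <> 0 ->
  (forall m n, (m + n <= 5)%nat -> d1 (m + 2)%nat n = - d1 m (n + 2)%nat - e1 m n / a1) ->
  (forall m n, (m + n <= 5)%nat -> d2 (m + 2)%nat n = - d2 m (n + 2)%nat - e2 m n / a2) ->
  (forall n, (n <= 7)%nat -> p n = d2 0%nat n - d1 0%nat n) ->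
  (forall n, (n <= 6)%nat -> q n = a2 * d2 1%nat n - a1 * d1 1%nat n) ->
  let C := stencil (a1 / a2) in
  Lh C (fun k l => taylor2 7 (if (k =? -1)%Z then d1 else d2) (IZR k * h) (IZR l * h)) =
    / a1 * sum_Lambda 5 (fun m n => e1 m n * Hminus C h m n)
    + / a2 * sum_Lambda 5 (fun m n => e2 m n * Hplus C h m n)
    - sum_f_R0 (fun n => p n * calG C h 0 n) 7
    - / a1 * sum_f_R0 (fun n => q n * calG C h 1 n) 6.
Proof.
  intros Ha1 Ha2 Hd1 Hd2 Hp Hq C.
  assert (HL : Lh C (fun k l =>
      taylor2 7 (if (k =? -1)%Z then d1 else d2) (IZR k * h) (IZR l * h)) =
    left_sum C h (taylor2 7 d1) + right_sum C h (taylor2 7 d2)).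
  { unfold Lh, left_sum, right_sum, sumZ; simpl.
    replace (IZR (-1) * h) with (- h) by ring; ring. }
  assert (H1 := linear_functional_poisson _ a1 d1 e1 (left_sum_linear C h)).
  assert (H2 := linear_functional_poisson _ a2 d2 e2 (right_sum_linear C h)).
  replace (left_sum C h (taylor2 7 d1)) with (left_sum C h (fun s t =>
      sum_f_R0 (fun n => d1 0%nat n * G 0 n s t) 7
      + sum_f_R0 (fun n => d1 1%nat n * G 1 n s t) 6
      + / a1 * sum_Lambda 5 (fun m n => e1 m n * H m n s t))) in HL
    by (unfold left_sum, sumZ, fold_right; now rewrite !(taylor2_poisson a1 d1 e1)).
  replace (right_sum C h (taylor2 7 d2)) with (right_sum C h (fun s t =>
      sum_f_R0 (fun n => d2 0%nat n * G 0 n s t) 7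
      + sum_f_R0 (fun n => d2 1%nat n * G 1 n s t) 6
      + / a2 * sum_Lambda 5 (fun m n => e2 m n * H m n s t))) in HL
    by (unfold right_sum, sumZ, fold_right; now rewrite !(taylor2_poisson a2 d2 e2)).
  rewrite HL, H1, H2; clear HL H1 H2.
  change (fun m n => e1 m n * left_sum C h (H m n))
    with (fun m n => e1 m n * Hminus C h m n).
  change (fun m n => e2 m n * right_sum C h (H m n))
    with (fun m n => e2 m n * Hplus C h m n).
  rewrite (sum_eq (fun n => p n * calG C h 0 n) (fun n =>
      d2 0%nat n * right_sum C h (G 0 n) * (-1) + d1 0%nat n * left_sum C h (G 0 n) * (-1))).
  2:{ intros n Hn; rewrite (Hp n Hn).
      assert (Hc := stencil_G0 (a1 / a2) h n Hn); fold C in Hc.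
      change (left_sum C h (G 0 n)) with (calG C h 0 n); rewrite Hc; ring. }
  (* Since [a2 * (a1 / a2) = a1], both sides of the interface acquire the factor [- a1], which the
     prefactor [/ a1] cancels. *)
  rewrite (sum_eq (fun n => q n * calG C h 1 n) (fun n =>
      d2 1%nat n * right_sum C h (G 1 n) * (- a1)
      + d1 1%nat n * left_sum C h (G 1 n) * (- a1))).
  2:{ intros n Hn; rewrite (Hq n Hn).
      assert (Hc := stencil_G1 (a1 / a2) h n Hn); fold C in Hc.
      change (left_sum C h (G 1 n)) with (calG C h 1 n); rewrite Hc; field; trivial. }
  rewrite !sum_plus, <- !scal_sum; field; split; trivial.
Qed.

(** * Uniform Lipschitz constants, the equation on each piece, and the mesh *)

Lemma lipschitz_on_family (A : R -> R -> Prop) (w : nat -> nat -> R -> R -> R) (M : nat) :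
  (forall m n, (m + n = M)%nat -> lipschitz_on A (w m n)) ->
  exists L, 0 <= L /\ forall m n, (m + n = M)%nat ->
    forall x y x' y', A x y -> A x' y' ->
    Rabs (w m n x y - w m n x' y') <= L * (Rabs (x - x') + Rabs (y - y')).
Proof.
  intros Hw.
  assert (HK : forall K, exists L, 0 <= L /\ forall m n, (m < K)%nat -> (m + n = M)%nat ->
    forall x y x' y', A x y -> A x' y' ->
    Rabs (w m n x y - w m n x' y') <= L * (Rabs (x - x') + Rabs (y - y'))).
  { induction K as [|K [L [HL IHK]]].
    - exists 0; split; [lra | intros; lia].
    - destruct (le_lt_dec K M) as [HKM|HKM].
      + destruct (Hw K (M - K)%nat ltac:(lia)) as [L' HL'].
        (* [lipschitz_on] does not force its constant to be nonnegative, hence the absolute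
           value. *)
        exists (L + Rabs L'); split; [assert (H := Rabs_pos L'); lra|].
        intros m n Hm Hmn x y x' y' Hxy Hxy'.
        assert (H1 := Rabs_pos (x - x')); assert (H2 := Rabs_pos (y - y')).
        assert (H3 := Rle_abs L'); assert (H4 := Rabs_pos L').
        destruct (Nat.eq_dec m K) as [->|Hne].
        * replace (M - K)%nat with n in HL' by lia.
          specialize (HL' x y x' y' Hxy Hxy'); nra.
        * specialize (IHK m n ltac:(lia) Hmn x y x' y' Hxy Hxy'); nra.
      + exists L; split; trivial; intros; apply IHK; trivial; lia. }
  destruct (HK (S M)) as [L [HL H]]; exists L; split; trivial.
  intros; apply H; trivial; lia.
Qed.

Lemma dx_dx_solution (D : cross) (ap : piece -> R) (a f g u : R -> R -> R)
  (phi psi : piece -> R -> R) (p : piece) :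
  (forall p, 0 < ap p) ->
  (forall p x y, Omega_ D p x y -> a x y = ap p) ->
  exact_solution D a f phi psi g u ->
  forall x y, Omega_ D p x y -> dx (dx u) x y = - dy (dy u) x y - f x y / ap p.
Proof.
  intros Hap Ha Hsol x y Hxy.
  (* As an open rectangle, the piece contains a neighbourhood on each line through [(x, y)]; there
     [a] is constant and can be taken out of the derivatives. *)
  assert (Hrect : exists xa xb ya yb, Omega_ D p = rect xa xb ya yb).
  { destruct p; do 4 eexists; reflexivity. }
  assert (HO : Omega D x y /\ ~ Gamma D x y).
  { assert (H1 := xi_in D); assert (H2 := zeta_in D); split.
    - unfold Omega; destruct p; simpl in Hxy; lra.
    - intros [[p' Hp']|Hp']; [destruct p'|]; destruct p; simpl in *; lra. }
  destruct (solves_pde _ _ _ _ _ _ _ Hsol x y (proj1 HO) (proj2 HO))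
    as (_ & _ & _ & _ & Heq).
  destruct Hrect as (xa & xb & ya & yb & Hrect).
  assert (Hx : Derive (fun t => a t y * dx u t y) x = ap p * dx (dx u) x y).
  { unfold dx at 2; rewrite <- Derive_scal; apply Derive_ext_loc.
    rewrite Hrect in Hxy; destruct Hxy as [Hx Hy].
    apply locally_open_interval with (1 := Hx); intros t Ht; f_equal.
    apply Ha; rewrite Hrect; now split. }
  assert (Hy : Derive (fun t => a x t * dy u x t) y = ap p * dy (dy u) x y).
  { unfold dy at 2; rewrite <- Derive_scal; apply Derive_ext_loc.
    rewrite Hrect in Hxy; destruct Hxy as [Hx' Hy].
    apply locally_open_interval with (1 := Hy); intros t Ht; f_equal.
    apply Ha; rewrite Hrect; now split. }
  rewrite Hx, Hy in Heq; rewrite <- Heq.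
  field; apply Rgt_not_eq, Hap.
Qed.

(** The sides of the domain and the lines through [(xi, zeta)] are grid lines, and distinct grid
    lines are at least [h] apart. Hence the stencil stays in the closures of the first two
    pieces. *)
Lemma mesh_neighbours (D : cross) (N1 i0 j0 i j : nat) :
  let h := mesh_size D N1 in
  (0 < N1)%nat -> xi D = grid_x D N1 i0 -> zeta D = grid_y D N1 j0 ->
  Gamma_ D P1 (grid_x D N1 i) (grid_y D N1 j) ->
  0 < h /\ l1 D <= xi D - h /\ xi D + h <= l2 D /\
  zeta D <= grid_y D N1 j - h /\ grid_y D N1 j + h <= l4 D.
Proof.
  intros h HN Hi0 Hj0 [_ [Hj1 Hj2]].
  assert (HN' : 0 < INR N1) by now apply lt_0_INR.
  assert (Hlt := l1_lt_l2 D).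
  assert (Hh : 0 < h) by (apply Rdiv_lt_0_compat; lra).
  assert (Hl2 : l2 D = l1 D + INR N1 * h) by (unfold h, mesh_size; field; lra).
  assert (Hl4 : l4 D = l3 D + INR (Defs.N0 D * N1) * h).
  { assert (Hs := sides D); rewrite mult_INR; rewrite Hl2 in Hs.
    ring_simplify in Hs; lra. }
  assert (Hstep : forall m n, INR m * h < INR n * h -> INR m * h + h <= INR n * h).
  { intros m n Hmn; apply Rmult_lt_reg_r in Hmn; trivial; apply INR_lt in Hmn.
    apply le_INR in Hmn; rewrite S_INR in Hmn; nra. }
  destruct (xi_in D) as [Hxi1 Hxi2].
  unfold grid_x in Hi0; unfold grid_y in *; fold h in Hi0, Hj0, Hj1, Hj2 |- *.
  rewrite Hi0 in Hxi1, Hxi2 |- *; rewrite Hj0 in Hj1 |- *; rewrite Hl2 in Hxi2 |- *;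
    rewrite Hl4 in Hj2 |- *.
  assert (H1 := Hstep 0%nat i0); assert (H2 := Hstep i0 N1);
    assert (H3 := Hstep j0 j); assert (H4 := Hstep j (Defs.N0 D * N1)%nat).
  simpl (INR 0) in H1; lra.
Qed.

(** * The consistency estimate *)

Theorem theorem2p2
  (D : cross) (ap : piece -> R) (a f g u : R -> R -> R)
  (phi psi : piece -> R -> R)
  (ap_pos : forall p, 0 < ap p)
  (a_piecewise : forall p x y, Omega_ D p x y -> a x y = ap p)
  (u_solution : exact_solution D a f phi psi g u)
  (u_regular : forall p, p = P1 \/ p = P2 -> uc_partials (Omega_ D p) 7 u)
  (f_regular : forall p, p = P1 \/ p = P2 -> uc_partials (Omega_ D p) 5 f)
  (phi1_regular : uc_derivatives (fun y => zeta D < y < l4 D) 7 (phi P1))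
  (psi1_regular : uc_derivatives (fun y => zeta D < y < l4 D) 6 (psi P1))
  (* Uniform continuity of the seventh-order derivatives alone gives only o(h^6). *)
  (u_order_seven_lipschitz : forall p, p = P1 \/ p = P2 ->
     forall m n, (m + n = 7)%nat -> lipschitz_on (Omega_ D p) (partial_derive m n u)) :
  exists K h0 : R, 0 < h0 /\
  forall N1 i0 j0 i j : nat,
    let h := mesh_size D N1 in
    let C := stencil (ap P1 / ap P2) in
    (0 < N1)%nat ->
    h < h0 ->
    grid_index D N1 i0 j0 -> xi D = grid_x D N1 i0 -> zeta D = grid_y D N1 j0 ->
    grid_index D N1 i j -> Gamma_ D P1 (grid_x D N1 i) (grid_y D N1 j) ->
    Rabs (/ h * (Lh C (exact_values D u h (grid_x D N1 i) (grid_y D N1 j))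
                 - rhs_F D (ap P1) (ap P2) f (phi P1) (psi P1) C h
                     (grid_x D N1 i) (grid_y D N1 j)))
    <= K * h ^ 7.
Proof.
  assert (Hu1 := u_regular P1 (or_introl eq_refl)).
  assert (Hu2 := u_regular P2 (or_intror eq_refl)).
  assert (Hf1 := f_regular P1 (or_introl eq_refl)).
  assert (Hf2 := f_regular P2 (or_intror eq_refl)).
  destruct (lipschitz_on_family _ (fun m n => partial_derive m n u) 7
    (u_order_seven_lipschitz P1 (or_introl eq_refl))) as [L1 [HL1 Hlip1]].
  destruct (lipschitz_on_family _ (fun m n => partial_derive m n u) 7
    (u_order_seven_lipschitz P2 (or_intror eq_refl))) as [L2 [HL2 Hlip2]].
  assert (Hpde1 := dx_dx_solution D ap a f g u phi psi P1 ap_pos a_piecewise u_solution).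
  assert (Hpde2 := dx_dx_solution D ap a f g u phi psi P2 ap_pos a_piecewise u_solution).
  assert (Ha1 := ap_pos P1); assert (Ha2 := ap_pos P2).
  destruct (xi_in D) as [Hxi1 Hxi2]; destruct (zeta_in D) as [Hze1 Hze2].
  set (A1 := rect (l1 D) (xi D) (zeta D) (l4 D)).
  set (A2 := rect (xi D) (l2 D) (zeta D) (l4 D)).
  change (Omega_ D P1) with A1 in Hu1, Hf1, Hlip1, Hpde1.
  change (Omega_ D P2) with A2 in Hu2, Hf2, Hlip2, Hpde2.
  assert (Hphi : forall n, (n <= 7)%nat -> forall y, zeta D < y < l4 D ->
    Derive_n (phi P1) n y = 1 * limit_from A2 (partial_derive 0 n u) (xi D) y
                          - 1 * limit_from A1 (partial_derive 0 n u) (xi D) y).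
  { intros n Hn.
    apply (Derive_n_limit_from_jump (l1 D) (l2 D) (xi D) (zeta D) (l4 D) 1 1 7 0);
      trivial; [lra|].
    intros y Hy.
    destruct (has_jumps _ _ _ _ _ _ _ u_solution P1 (xi D) y (conj eq_refl Hy)) as [Hj _].
    apply (jump_limit_from (l1 D) (l2 D) (xi D) (zeta D) (l4 D) 1 1 y (phi P1 y) u u);
      trivial;
      try lra; try (intros; ring); now apply uc_partials_uc with 7%nat. }
  assert (Hpsi : forall n, (n <= 6)%nat -> forall y, zeta D < y < l4 D ->
    Derive_n (psi P1) n y = ap P2 * limit_from A2 (partial_derive 1 n u) (xi D) y
                          - ap P1 * limit_from A1 (partial_derive 1 n u) (xi D) y).
  { intros n Hn.
    apply (Derive_n_limit_from_jump (l1 D) (l2 D) (xi D) (zeta D) (l4 D)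
             (ap P1) (ap P2) 7 1); trivial; [lra | | lia].
    intros y Hy.
    destruct (has_jumps _ _ _ _ _ _ _ u_solution P1 (xi D) y (conj eq_refl Hy)) as [_ Hj].
    apply (jump_limit_from (l1 D) (l2 D) (xi D) (zeta D) (l4 D) (ap P1) (ap P2) y
             (psi P1 y) (partial_derive 1 0 u) (fun x y => a x y * dx u x y));
      trivial; try lra; try (apply uc_partials_partial_derive_uc with 7%nat; trivial; lia).
    - intros x Hx; now rewrite (a_piecewise P1 x y (conj Hx Hy)).
    - intros x Hx; now rewrite (a_piecewise P2 x y (conj Hx Hy)). }
  set (L := L1 + L2).
  set (alpha := ap P1 / ap P2).
  assert (Halpha : 0 < alpha) by now apply Rdiv_lt_0_compat.
  (* The first factor is the absolute coefficient sum of the stencil; the second is the Taylor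
     constant for [M = 7], with [L] dominating the Lipschitz constants of both sides. *)
  exists (20 * (1 + alpha) * (INR (7 + 2) * L)), 1; split; [lra|].
  intros N1 i0 j0 i j h C HN _ _ Hi0 Hj0 _ Hij.
  destruct (mesh_neighbours D N1 i0 j0 i j HN Hi0 Hj0 Hij)
    as (Hh & Hm1 & Hm2 & Hm3 & Hm4); fold h in Hh, Hm1, Hm2, Hm3, Hm4.
  destruct Hij as [Hx Hy]; rewrite Hx; set (y := grid_y D N1 j) in *.
  set (d1 := fun m n => limit_from A1 (partial_derive m n u) (xi D) y).
  set (d2 := fun m n => limit_from A2 (partial_derive m n u) (xi D) y).
  assert (HT : rhs_F D (ap P1) (ap P2) f (phi P1) (psi P1) C h (xi D) y =
    Lh C (fun k l => taylor2 7 (if (k =? -1)%Z then d1 else d2) (IZR k * h) (IZR l * h))).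
  { symmetry.
    apply (Lh_taylor2 (ap P1) (ap P2) h d1 d2
      (fun m n => limit_from A1 (partial_derive m n f) (xi D) y)
      (fun m n => limit_from A2 (partial_derive m n f) (xi D) y)
      (fun n => Derive_n (phi P1) n y) (fun n => Derive_n (psi P1) n y)); try lra.
    - intros m n Hmn; apply (limit_from_poisson _ _ _ _ _ 5); trivial; try split; lra.
    - intros m n Hmn; apply (limit_from_poisson _ _ _ _ _ 5); trivial; try split; lra.
    - intros n Hn; rewrite (Hphi n Hn y Hy); unfold d1, d2; ring.
    - intros n Hn; exact (Hpsi n Hn y Hy). }
  rewrite HT, Rabs_mult, Rabs_pos_eq by (left; now apply Rinv_0_lt_compat).
  (* Clearing [/ h] leaves a bound of order [h ^ 8] to be proved, which is the order of the nodewise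
     Taylor remainders. *)
  apply Rmult_le_reg_l with h; trivial.
  rewrite <- Rmult_assoc, Rinv_r, Rmult_1_l by lra.
  replace (h * (20 * (1 + alpha) * (INR (7 + 2) * L) * h ^ 7))
    with (20 * (1 + alpha) * (INR (7 + 2) * L * h ^ 8)) by ring.
  apply Lh_close; trivial.
  assert (Hh8 : forall L', 0 <= L' <= L ->
    INR (7 + 2) * L' * h ^ 8 <= INR (7 + 2) * L * h ^ 8).
  { intros L' HL'; apply Rmult_le_compat_r; [apply pow_le; lra|].
    apply Rmult_le_compat_l; [apply pos_INR | lra]. }
  intros k l Hk Hl; unfold exact_values.
  assert (Hl' : Rabs (IZR l * h) <= h /\ zeta D <= y + IZR l * h <= l4 D).
  { simpl in Hl; destruct Hl as [<-|[<-|[<-|[]]]]; split; try lra;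
      apply Rabs_le; lra. }
  destruct Hl' as [Hlh Hyl].
  assert (Hkh : Rabs (IZR k * h) <= h).
  { simpl in Hk; destruct Hk as [<-|[<-|[<-|[]]]]; apply Rabs_le; lra. }
  (* Column -1 is estimated on the first piece, columns 0 and 1 on the second; the nodes with
     [k = 0] lie on its left edge, where the boundary version of Taylor's formula applies. *)
  destruct (Z.eqb_spec k (-1)) as [->|Hk1].
  - apply Rle_trans with (2 := Hh8 L1 ltac:(unfold L; lra)).
    apply (limit_from_taylor2 _ _ _ _ 7 u L1); trivial; try split; lra.
  - apply Rle_trans with (2 := Hh8 L2 ltac:(unfold L; lra)).
    apply (limit_from_taylor2 _ _ _ _ 7 u L2); trivial; try split; try lra.
    simpl in Hk; destruct Hk as [<-|[<-|[<-|[]]]]; lia || lra.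
Qed.
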